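(* Let $G$ be a triangle-free $2$-self-centered graph. Then $G$ is planar if and only if $G$ is isomorphic to one of the following: (1) a complete bipartite graph $K_{2,d}$ for some $d\ge 2$; (2) a blow-up of the $5$-cycle $C_5=u_0u_1u_2u_3u_4$ at $\{u_1,u_3\}$, that is, a graph obtained from $C_5$ by replacing $u_1$ and $u_3$ with independent sets $V_1$ and $V_3$, each of size at least one, so that for each $i\in\{1,3\}$ each vertex in $V_i$ is adjacent to both $u_{i-1}$ and $u_{i+1}$ (and there are no other edges besides these and the edge $u_4u_0$).
   Context: All graphs are finite and simple. A graph is $2$-self-centered if its diameter and its radius (maximum and minimum eccentricity of a vertex) are both $2$. *)

(* Defs.v *)
From HB Require Import structures.
From mathcomp Require Import all_boot all_order all_algebra.
From mathcomp Require Import all_classical all_reals all_analysis.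

Set Implicit Arguments.
Unset Strict Implicit.
Unset Printing Implicit Defensive.

Import Order.TTheory GRing.Theory Num.Theory.
Import numFieldNormedType.Exports.

Local Open Scope classical_set_scope.

Record sgraph := SGraph {
  vertex :> finType;
  adj : rel vertex;
  adj_sym : symmetric adj;
  adj_irrefl : irreflexive adj }.

Definition isomorphic (G H : sgraph) : Prop :=
  exists2 f : G -> H, bijective f & {mono f : x y / adj x y}.

Definition triangle_free (G : sgraph) : Prop :=
  forall x y z : G, ~ [/\ adj x y, adj y z & adj z x].

Section Distance.
Variable G : sgraph.

Definition has_walk (n : nat) (x y : G) : bool :=
  [exists p : n.-tuple G, path (@adj G) x p && (last x p == y)].

(* A shortest walk has fewer than #|G| edges; [find] returns the junk value
   #|G| exactly when x and y lie in different components, which is why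
   [two_self_centered] also requires connectedness. *)
Definition dist (x y : G) : nat :=
  find (fun n => has_walk n x y) (iota 0 #|G|).

Definition connected_graph : Prop := forall x y : G, connect (@adj G) x y.

Definition ecc (x : G) : nat := \max_(y : G) dist x y.

Definition diameter : nat := \max_(x : G) ecc x.

(* The default value [diameter] is an upper bound of all eccentricities, so it
   does not affect the minimum when G has a vertex. *)
Definition radius : nat := \big[minn/diameter]_(x : G) ecc x.

Definition two_self_centered : Prop :=
  [/\ connected_graph, diameter = 2 & radius = 2].

End Distance.

Section Planarity.
Variable R : realType.

Definition arc_between (A : set (R * R)) (a b : R * R) : Prop :=
  exists g : R -> R * R,
    [/\ {within `[0%R, 1%R], continuous g},
        {in `[0%R, 1%R] &, injective g},
        g 0%R = a, g 1%R = b & g @` `[0%R, 1%R] = A].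

(* [pt] places the vertices and [curve E] is the arc of the edge whose set of
   ends is E.  The last two conditions say that the interior of an arc contains
   no vertex and no point of any other arc. *)
Definition planar (G : sgraph) : Prop :=
  exists (pt : G -> R * R) (curve : {set G} -> set (R * R)),
    [/\ injective pt,
        forall x y : G, adj x y ->
          arc_between (curve [set x; y]%SET) (pt x) (pt y),
        forall x y z : G, adj x y -> curve [set x; y]%SET (pt z) ->
          z = x \/ z = y
      & forall x y x' y' : G, adj x y -> adj x' y' ->
          [set x; y]%SET <> [set x'; y']%SET ->
          curve [set x; y]%SET `&` curve [set x'; y']%SET `<=` range pt].

End Planarity.

Section CompleteBipartite.
Variables m n : nat.

Definition biclique_adj (x y : 'I_m + 'I_n) : bool :=
  match x, y with
  | inl _, inr _ | inr _, inl _ => true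
  | _, _ => false
  end.

Lemma biclique_sym : symmetric biclique_adj.
Proof. by case=> ? [?|?]. Qed.

Lemma biclique_irrefl : irreflexive biclique_adj.
Proof. by case. Qed.

Definition biclique : sgraph := SGraph biclique_sym biclique_irrefl.

End CompleteBipartite.

Section FiveCycle.

Definition C5_adj (i j : 'I_5) : bool := (j == ordS i) || (i == ordS j).

Lemma C5_sym : symmetric C5_adj.
Proof. by move=> i j; rewrite /C5_adj orbC. Qed.

Lemma C5_irrefl : irreflexive C5_adj.
Proof. by case; do 5?case=> //. Qed.

Definition C5 : sgraph := SGraph C5_sym C5_irrefl.

End FiveCycle.

Section BlowUp.
Variables (G : sgraph) (w : G -> nat).

Definition blowup_adj (u v : {x : G & 'I_(w x)}) : bool :=
  adj (tag u) (tag v).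

Lemma blowup_sym : symmetric blowup_adj.
Proof. by move=> u v; rewrite /blowup_adj adj_sym. Qed.

Lemma blowup_irrefl : irreflexive blowup_adj.
Proof. by move=> u; rewrite /blowup_adj adj_irrefl. Qed.

(* Each vertex x is replaced with an independent set of size [w x]. *)
Definition blowup : sgraph := SGraph blowup_sym blowup_irrefl.

End BlowUp.

Definition C5_weight (a b : nat) (i : C5) : nat :=
  match nat_of_ord i with 1 => a | 3 => b | _ => 1 end.

Definition C5_blowup13 (a b : nat) : sgraph := blowup (C5_weight a b).

(* Main.v *)
Require Import Defs.
From mathcomp Require Import all_boot all_order all_algebra zify ring lra.
From mathcomp Require Import all_classical all_reals all_analysis.

(** The only consequence of planarity needed is the absence of subdivisions of
    [K_{3,3}].  If [G] is bipartite, diameter two makes it complete bipartite, and it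
    contains [K_{3,3}] unless one side has two vertices.  Otherwise two adjacent
    non-neighbours of a vertex give a 5-cycle; a vertex with fewer than two neighbours
    on the cycle, or two vertices playing the roles of consecutive cycle vertices,
    produce a subdivision of [K_{3,3}] through the common neighbours that diameter two
    provides, so that [G] is a blow-up at two non-consecutive vertices.

    No Jordan curve theorem is needed to see that a subdivision of [K_{3,3}] has no
    planar drawing.  Arcs of vertex-disjoint paths are at positive distance, so they
    can be replaced with walks on a fine square lattice such that the walks of
    independent edges have no common lattice point.  For two walks [P], [Q] without
    common point, the ray-crossing parities of [P] at the ends of [Q] and of [Q] at
    the ends of [P] satisfy a linear relation mod 2; summed over the 18 pairs of
    independent edges of [K_{3,3}] these relations read [1 = 0] (van Kampen's
    obstruction).

    Conversely a blow-up of the 5-cycle, as well as [K_{2,d}], is drawn with straight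
    segments. *)

Set Implicit Arguments.
Unset Strict Implicit.
Unset Printing Implicit Defensive.

Import Order.TTheory GRing.Theory Num.Theory.
Import numFieldNormedType.Exports.

Local Notation gridpt := (int * int)%type.

(** * Parity of disjoint lattice walks *)

Section LatticeWalks.
Local Open Scope ring_scope.

Definition rook_up (u v : gridpt) : bool :=
  (v == (u.1 + 1, u.2)) || (v == (u.1, u.2 + 1)).

Definition rook : rel gridpt := fun u v => rook_up u v || rook_up v u.

(* The step uv crosses the vertical ray going up from q + (1/2, 1/2). *)
Definition above (q u v : gridpt) : bool :=
  [&& u.1 != v.1, Num.min u.1 v.1 == q.1 & q.2 < u.2].

Definition precedes (p q : gridpt) : bool :=
  (p.1 < q.1) || (p.1 == q.1) && (q.2 < p.2).

(* Let X(P, Q) count the crossings of P with Q + (1/2, 1/2); it vanishes when P and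
   Q have no common point.  Modulo 2 it is the number of crossings of P with the
   upward rays from the ends of Q + (1/2, 1/2) plus that of Q + (1/2, 1/2) with the
   downward rays from the ends of P.  Replacing the latter with upward rays costs
   the [precedes] terms. *)
Definition step_sum (u v q r : gridpt) : nat :=
  (above q u v + above r u v + above u q r + above v q r +
   precedes q u + precedes q v + precedes r u + precedes r v)%N.

Lemma int_near_cases (x y : int) :
  x + 1 < y \/ y = x + 1 \/ y = x \/ x = y + 1 \/ y + 1 < x.
Proof. lia. Qed.

Ltac decide_comparisons := repeat match goal with
  | |- context [@eq_op _ ?a ?b] =>
    first [have -> : (a == b) = true by lia | have -> : (a == b) = false by lia]
  | |- context [@Order.lt _ _ ?a ?b] =>
    first [have -> : (a < b) = true by lia | have -> : (a < b) = false by lia]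
  end.

(** Only coordinate differences matter, and those beyond 1 on the same side all behave alike; five
    ranges per coordinate and the directions of the two steps leave finitely many cases. *)
Lemma step_parity_up (u v q r : gridpt) :
  rook_up u v -> rook_up q r -> u != q -> u != r -> v != q -> v != r ->
  ~~ odd (step_sum u v q r).
Proof.
case: u => ux uy; case: q => qx qy.
rewrite /rook_up /step_sum !oddD !oddb /above /precedes.
have min_succ (x : int) : Num.min x (x + 1) = x by lia.
case/orP => /eqP->; case/orP => /eqP-> /=; rewrite !xpair_eqE ?min_succ ?minxx;
have [?|[?|[?|[?|?]]]] := int_near_cases ux qx;
have [?|[?|[?|[?|?]]]] := int_near_cases uy qy; subst; decide_comparisons => //.
Qed.

(** Only horizontal steps count, and their two ends have the same height. *)
Lemma above_sym (q u v : gridpt) : rook u v -> above q u v = above q v u.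
Proof.
rewrite /rook /rook_up /above minC; case: u v => [ux uy] [vx vy] /=.
rewrite !xpair_eqE (eq_sym ux vx) => uv; have [//|vx_ux] := eqVneq vx ux.
by have -> : uy = vy by lia.
Qed.

Lemma step_sum_symr (u v q r : gridpt) :
  rook q r -> step_sum u v q r = step_sum u v r q.
Proof. by move=> qr; rewrite /step_sum !(above_sym _ qr); ring. Qed.

Lemma step_sum_syml (u v q r : gridpt) :
  rook u v -> step_sum u v q r = step_sum v u q r.
Proof. by move=> uv; rewrite /step_sum !(above_sym _ uv); ring. Qed.

Lemma step_parity (u v q r : gridpt) :
  rook u v -> rook q r -> u != q -> u != r -> v != q -> v != r ->
  ~~ odd (step_sum u v q r).
Proof.
move=> uv qr uq ur vq vr.
wlog uv' : u v uv uq ur vq vr / rook_up u v.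
  by move=> H; have [/H->//|vu] := orP uv; rewrite step_sum_syml // H // /rook orbC.
wlog qr' : q r qr uq ur vq vr / rook_up q r.
  by move=> H; have [/H->//|rq] := orP qr; rewrite step_sum_symr // H // /rook orbC.
exact: step_parity_up.
Qed.

Fixpoint walk_above (q u : gridpt) (p : seq gridpt) : nat :=
  if p is v :: p' then (above q u v + walk_above q v p')%N else 0%N.

(** The analogue of [step_sum] for walks: crossings are counted along the whole walks, but rays
    start only at their ends. *)
Definition walk_sum (u : gridpt) (p : seq gridpt) (q : gridpt) (s : seq gridpt) : nat :=
  (walk_above q u p + walk_above (last q s) u p +
   walk_above u q s + walk_above (last u p) q s +
   precedes q u + precedes q (last u p) +
   precedes (last q s) u + precedes (last q s) (last u p))%N.

Lemma odd_of_double_diff (m n k : nat) : (m + 2 * k)%N = n -> odd m = odd n.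
Proof. by move=> <-; rewrite oddD oddM addbF. Qed.

Lemma even_double (n : nat) : ~~ odd n -> exists m, n = (2 * m)%N.
Proof. by move=> /negPf even_n; exists n./2; rewrite -{1}[n]odd_double_half even_n mul2n. Qed.

Lemma step_walk_parity (u v q : gridpt) (s : seq gridpt) :
  rook u v -> path rook q s -> u \notin q :: s -> v \notin q :: s ->
  ~~ odd (walk_sum u [:: v] q s).
Proof.
move=> uv; elim: s q => [|r s IH] q.
  have -> : walk_sum u [:: v] q [::] =
      (2 * (above q u v + precedes q u + precedes q v))%N by rewrite /walk_sum /=; ring.
  by rewrite mul2n odd_double.
have notin_cons (x y : gridpt) t : x \notin y :: t -> x != y /\ x \notin t.
  by rewrite in_cons negb_or => /andP.
case/andP=> qr rs /notin_cons[uq us] /notin_cons[vq vs].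
have [[ur _] [vr _]] := (notin_cons _ _ _ us, notin_cons _ _ _ vs).
(* The sum telescopes: terms at the junction [r] occur in both summands and cancel mod 2. *)
have : (walk_sum u [:: v] q (r :: s) + 2 * (above r u v + precedes r u + precedes r v) =
    step_sum u v q r + walk_sum u [:: v] r s)%N by rewrite /walk_sum /step_sum /=; ring.
move/odd_of_double_diff->; rewrite oddD.
by rewrite (negPf (step_parity _ _ _ _ _ _)) ?(negPf (IH _ _ _ _)).
Qed.

Lemma walk_parity (u q : gridpt) (p s : seq gridpt) :
  path rook u p -> path rook q s -> {in u :: p, forall z, z \notin q :: s} ->
  ~~ odd (walk_sum u p q s).
Proof.
move=> + qs; elim: p u => [|v p IH] u.
  move=> _ _; have -> : walk_sum u [::] q s =
    (2 * (walk_above u q s + precedes q u + precedes (last q s) u))%N.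
    by rewrite /walk_sum /=; ring.
  by rewrite mul2n odd_double.
case/andP=> uv vp D.
have uD : u \notin q :: s by apply: D; rewrite !inE eqxx.
have vD : v \notin q :: s by apply: D; rewrite !inE eqxx orbT.
have vpD : {in v :: p, forall z, z \notin q :: s}.
  by move=> z zp; apply: D; rewrite in_cons zp orbT.
(* Telescoping again, now along the first walk with junction [v]. *)
have : (walk_sum u (v :: p) q s +
    2 * (walk_above v q s + precedes q v + precedes (last q s) v) =
    walk_sum u [:: v] q s + walk_sum v p q s)%N by rewrite /walk_sum /=; ring.
move/odd_of_double_diff->; rewrite oddD.
by rewrite (negPf (step_walk_parity uv qs uD vD)) (negPf (IH v vp vpD)).
Qed.

(** Since [precedes] is a strict total order, the two orders of a pair of distinct points contribute
    exactly 1; the odd total for [K_{3,3}] comes from this. *)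
Lemma precedesN (u v : gridpt) : u != v -> precedes v u = ~~ precedes u v.
Proof.
case: u v => [ux uy] [vx vy]; rewrite /precedes xpair_eqE /=.
by case: (ltgtP ux vx) => //= _; case: ltgtP.
Qed.

Lemma no_disjoint_K33_walks (a b : 'I_3 -> gridpt) (p : 'I_3 -> 'I_3 -> seq gridpt) :
  (forall i j, path rook (a i) (p i j)) -> (forall i j, last (a i) (p i j) = b j) ->
  ~ (forall i j k l, i != k -> j != l ->
       {in a i :: p i j, forall z, z \notin a k :: p k l}).
Proof.
move=> walk_p last_p D.
pose o0 : 'I_3 := @Ordinal 3 0 isT.
pose o1 : 'I_3 := @Ordinal 3 1 isT.
pose o2 : 'I_3 := @Ordinal 3 2 isT.
pose w i j q : nat := walk_above q (a i) (p i j).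
pose h u v : nat := precedes u v.
have E i j k l : i != k -> j != l -> exists m : nat,
    (w i j (a k) + w i j (b l) + w k l (a i) + w k l (b j) +
     h (a k) (a i) + h (a k) (b j) + h (b l) (a i) + h (b l) (b j) = 2 * m)%N.
  move=> ik jl; have := walk_parity (walk_p i j) (walk_p k l) (D i j k l ik jl).
  by rewrite /walk_sum !last_p; exact: even_double.
have hN u v : u != v -> (h u v + h v u = 1)%N.
  by rewrite /h => /precedesN ->; case: precedes.
have bp i j : b j \in a i :: p i j by rewrite -(last_p i j) mem_last.
have succ_neq (i : 'I_3) : i + 1 != i by case: i => [[|[|[]]]].
(* If [a i] and [b j] coincided, the walks from [a (i + 1)] to [b j] and from [a i] to [b (j + 1)],
   which belong to independent edges, would meet. *)
have ab i j : (h (a i) (b j) + h (b j) (a i) = 1)%N.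
  apply/hN/eqP => ab; have jj : j != j + 1 by rewrite eq_sym succ_neq.
  by have := D (i + 1) j i (j + 1) (succ_neq i) jj (b j) (bp _ _); rewrite -ab mem_head.
have bb i j : i != j -> (h (b i) (b j) + h (b j) (b i) = 1)%N.
  move=> ij; apply/hN/eqP => bij.
  by have := D o1 i o0 j isT ij (b i) (bp _ _); rewrite bij bp.
(* In the sum over the 18 pairs of independent edges each w-term occurs twice and
   each ordered pair (a_i, a_k) and each pair {a_i, b_j} occurs an even number of
   times, whereas each of the three pairs {b_j, b_l} contributes 3. *)
have {}E i k j l ik jl := E i j k l ik jl.
have [m1 E1] := E o0 o1 o0 o1 isT isT.
have [m2 E2] := E o0 o1 o0 o2 isT isT.
have [m3 E3] := E o0 o1 o1 o0 isT isT.
have [m4 E4] := E o0 o1 o1 o2 isT isT.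
have [m5 E5] := E o0 o1 o2 o0 isT isT.
have [m6 E6] := E o0 o1 o2 o1 isT isT.
have [n1 F1] := E o0 o2 o0 o1 isT isT.
have [n2 F2] := E o0 o2 o0 o2 isT isT.
have [n3 F3] := E o0 o2 o1 o0 isT isT.
have [n4 F4] := E o0 o2 o1 o2 isT isT.
have [n5 F5] := E o0 o2 o2 o0 isT isT.
have [n6 F6] := E o0 o2 o2 o1 isT isT.
have [k1 G1] := E o1 o2 o0 o1 isT isT.
have [k2 G2] := E o1 o2 o0 o2 isT isT.
have [k3 G3] := E o1 o2 o1 o0 isT isT.
have [k4 G4] := E o1 o2 o1 o2 isT isT.
have [k5 G5] := E o1 o2 o2 o0 isT isT.
have [k6 G6] := E o1 o2 o2 o1 isT isT.
have := ab o0 o0. have := ab o0 o1. have := ab o0 o2.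
have := ab o1 o0. have := ab o1 o1. have := ab o1 o2.
have := ab o2 o0. have := ab o2 o1. have := ab o2 o2.
have := bb o0 o1 isT. have := bb o0 o2 isT. have := bb o1 o2 isT.
move: E1 E2 E3 E4 E5 E6 F1 F2 F3 F4 F5 F6 G1 G2 G3 G4 G5 G6; clear.
lia.
Qed.

End LatticeWalks.

(** * Subdivisions of K33 are not planar *)

Section Nonplanarity.
Variable R : realType.
Local Open Scope ring_scope.
Local Open Scope classical_set_scope.

(** The points of [A] with property [P] form a nonempty set that is both open and closed relative to
    [A]. *)
Lemma locally_constant_connected (T : topologicalType) (A : set T) (P : T -> Prop) (x : T) :
  connected A -> A x -> P x ->
  (forall y, A y -> \forall z \near y, A z -> (P y <-> P z)) ->
  forall y, A y -> P y.
Proof.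
move=> cA Ax Px locP y Ay.
pose B := A `&` P.
suff : B = A by move=> BA; move: Ay; rewrite -BA => -[].
apply: cA.
- by exists x.
- exists (interior [set z | A z -> P z]); first exact: open_interior.
  rewrite /B predeqE => z; split => [[Az Pz]|[Az /nbhs_singleton]]; last by move=> /(_ Az).
  split => //; apply: filterS (locP z Az) => w; move=> zw /zw; tauto.
- exists (~` interior [set z | A z -> ~ P z]).
    exact/open_closedC/open_interior.
  rewrite /B predeqE => z; split => [[Az Pz]|[Az nPz]].
    by split => // /nbhs_singleton /(_ Az).
  split => //; apply: contrapT => Pz; apply: nPz.
  by apply: filterS (locP z Az) => w zw /zw; tauto.
Qed.

(** * Rounding arcs to lattice walks *)

Definition cell (e : R) (p : R * R) : gridpt := (Num.floor (p.1 / e), Num.floor (p.2 / e)).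

(** The tolerance [2 * e] covers the rounding error together with a displacement of less than [e],
    as needed for lattice points that mix coordinates of two nearby points. *)
Definition close_to (e : R) (C : set (R * R)) (z : gridpt) : Prop :=
  exists2 p, C p & `|z.1%:~R * e - p.1| <= 2 * e /\ `|z.2%:~R * e - p.2| <= 2 * e.

Definition reach (P : gridpt -> Prop) (u v : gridpt) : Prop :=
  exists p, [/\ path rook u p, last u p = v & forall z, z \in u :: p -> P z].

Lemma reach_trans (P : gridpt -> Prop) u v w : reach P u v -> reach P v w -> reach P u w.
Proof.
move=> [p [up <- Pp]] [q [uq <- Pq]]; exists (p ++ q).
rewrite cat_path up last_cat; split => // z; rewrite in_cons mem_cat.
case/or3P => [zu|zp|zq]; last by apply: Pq; rewrite in_cons zq orbT.
  by apply: Pp; rewrite in_cons zu.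
by apply: Pp; rewrite in_cons zp orbT.
Qed.

Lemma reach_sub (P Q : gridpt -> Prop) u v : (forall z, P z -> Q z) -> reach P u v -> reach Q u v.
Proof. by move=> PQ [p [up pv Pp]]; exists p; split => // z /Pp /PQ. Qed.

Lemma reach1 (P : gridpt -> Prop) u v : P u -> P v -> (u == v) || rook u v -> reach P u v.
Proof.
move=> Pu Pv /orP[/eqP <-|uv].
  by exists [::]; split => // z; rewrite inE => /eqP ->.
by exists [:: v]; rewrite /= uv; split => // z; rewrite !inE => /orP[]/eqP ->.
Qed.

Lemma floor_near (e a b : R) : 0 < e -> `|a - b| < e ->
  `|(Num.floor (a / e))%:~R * e - b| <= 2 * e.
Proof.
move=> e0 ab; have /andP[fl fu] := floor_itv (a / e).
rewrite ler_pdivlMr // in fl. rewrite ltr_pdivrMr // intrD mulrDl mul1r in fu.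
by move: ab; rewrite ltr_norml ler_norml; lra.
Qed.

Lemma floor_step (e a b : R) : 0 < e -> `|a - b| < e ->
  (`|Num.floor (a / e) - Num.floor (b / e)| <= 1)%R.
Proof.
set x := Num.floor (a / e); set y := Num.floor (b / e).
move=> e0 ab; have /andP[al au] := floor_itv (a / e).
have /andP[bl bu] := floor_itv (b / e).
rewrite -/x -/y in al au bl bu *.
have : `|a / e - b / e| < 1.
  by rewrite -mulrBl normrM normfV (gtr0_norm e0) ltr_pdivrMr // mul1r.
rewrite ltr_norml => /andP[abl abu].
have : (x%:~R : R) < (y + 2)%:~R by rewrite intrD in bu *; lra.
have : (y%:~R : R) < (x + 2)%:~R by rewrite intrD in au *; lra.
rewrite !ltr_int; lia.
Qed.

Lemma reach_local (e : R) (C : set (R * R)) p q : 0 < e -> C p ->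
  `|p.1 - q.1| < e -> `|p.2 - q.2| < e -> C q ->
  reach (close_to e C) (cell e p) (cell e q).
Proof.
move=> e0 Cp pq1 pq2 Cq.
have ee (x : R) : `|x - x| < e by rewrite subrr normr0.
(* The two cells may differ diagonally; the detour changes the first coordinate, then the second. *)
apply: (@reach_trans _ _ (Num.floor (q.1 / e), Num.floor (p.2 / e))).
  apply: reach1.
  - by exists p => //; split; apply: floor_near.
  - by exists p => //; split; apply: floor_near => //; rewrite distrC.
  - rewrite /cell /rook /rook_up /= !xpair_eqE.
    have := floor_step e0 pq1.
    move: (Num.floor _) (Num.floor _) (Num.floor _) => x y z; lia.
apply: reach1.
- by exists q => //; split; apply: floor_near.
- by exists q => //; split; apply: floor_near.
- rewrite /cell /rook /rook_up /= !xpair_eqE.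
  have := floor_step e0 pq2.
  move: (Num.floor _) (Num.floor _) (Num.floor _) => x y z; lia.
Qed.

(** By continuity, reachability of the cell of [g t] from that of [g 0] is locally constant in [t],
    and the unit interval is connected. *)
Lemma reach_arc (e : R) (A : set (R * R)) a b : 0 < e -> arc_between A a b ->
  reach (close_to e A) (cell e a) (cell e b).
Proof.
move=> e0 [g [cg _ <- <- <-]].
have Ig t : `[0, 1] t -> (g @` `[0, 1]) (g t) by exists t.
pose P t := reach (close_to e (g @` `[0, 1])) (cell e (g 0)) (cell e (g t)).
have I0 : `[0, 1] (0 : R) by rewrite /= in_itv /= lexx ler01.
have I1 : `[0, 1] (1 : R) by rewrite /= in_itv /= lexx ler01.
suff : forall t, `[0, 1] t -> P t by apply.
apply: (@locally_constant_connected _ _ P 0 (@segment_connected _ _ _)) => //.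
  by apply: reach_local; rewrite ?subrr ?normr0 //; apply: Ig.
move=> t It; have /subspace_continuousP/(_ t It) := cg.
move/cvg_ballP => /(_ e e0).
rewrite near_withinE; apply: filterS => s + Is => /(_ Is) [/= b1 b2].
rewrite /ball /= in b1 b2.
split=> h; apply: (reach_trans h); apply: reach_local => //; try exact: Ig.
all: by rewrite distrC.
Qed.

(** Each point of [A] is the centre of a ball missing [B]; half its radius serves all points near
    the centre, and compactness makes the choice uniform. *)
Lemma compact_separated (T : pseudoMetricType R) (A B : set T) :
  compact A -> closed B -> A `&` B = set0 ->
  \forall e \near (0 : R)^'+, forall p q, A p -> B q -> ~ ball p e q.
Proof.
move=> /compact_near_coveringP cA cB AB.
suff : \forall e \near (0 : R)^'+, A `<=` (fun p => forall q, B q -> ~ ball p e q).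
  by apply: filterS => e AB' p q Ap; exact: AB'.
apply: (cA R (0^'+) (fun e p => forall q, B q -> ~ ball p e q)) => p Ap.
have /open_nbhs_nbhs : open_nbhs p (~` B).
  split; first exact: closed_openC.
  by move=> Bp; have : (A `&` B) p by []; rewrite AB.
rewrite -nbhs_ballE => -[/= r r0 rB].
have r20 : 0 < r / 2 by rewrite divr_gt0.
exists (ball p (r / 2), [set e | e < r / 2]) => /=.
  split; first exact: nbhsx_ballx.
  exact: nbhs_right_lt.
move=> [x e] /= [px er] q Bq xq; apply: (rB q) Bq.
rewrite [r]splitr; apply: ball_triangle px _.
by apply: le_ball xq; exact: ltW.
Qed.

Lemma arc_compact (A : set (R * R)) a b : arc_between A a b -> compact A.
Proof.
by move=> [g [cg _ _ _ <-]]; apply: continuous_compact => //; exact: segment_compact.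
Qed.

(** Chords of a path [s] are included, so the set depends only on the members of [s]; disjoint
    vertex sets still give disjoint drawings. *)
Definition drawn (G : sgraph) (curve : {set G} -> set (R * R)) (s : seq G) : set (R * R) :=
  [set q | exists x y, [/\ x \in s, y \in s, adj x y & curve [set x; y]%SET q]].

Lemma drawn_sub (G : sgraph) (curve : {set G} -> set (R * R)) (s t : seq G) :
  {subset s <= t} -> drawn curve s `<=` drawn curve t.
Proof. by move=> st q [x [y [xs ys xy q']]]; exists x, y; split; auto. Qed.

Lemma reach_path (G : sgraph) (pt : G -> R * R) (curve : {set G} -> set (R * R)) (e : R) x s :
  (forall x y : G, adj x y -> arc_between (curve [set x; y]%SET) (pt x) (pt y)) ->
  0 < e -> (0 < size s)%N -> path (@adj G) x s ->
  reach (close_to e (drawn curve (x :: s))) (cell e (pt x)) (cell e (pt (last x s))).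
Proof.
move=> arcs e0; elim: s x => //= y s IH x _ /andP[xy ys].
have step : reach (close_to e (drawn curve [:: x, y & s])) (cell e (pt x)) (cell e (pt y)).
  apply: reach_sub (reach_arc e0 (arcs _ _ xy)) => z [q q1 q2].
  by exists q => //; exists x, y; rewrite !inE !eqxx orbT.
(* A single edge is the base case: one vertex alone spans no edge and has an empty drawing. *)
case: s IH ys step => [//|z s] IH ys step.
apply: reach_trans step _.
apply: reach_sub (IH y isT ys) => w [q q1 q2]; exists q => //.
by apply: drawn_sub q1 => v vs; rewrite inE vs orbT.
Qed.

Lemma planar_no_K33 (G : sgraph) (a b : 'I_3 -> G) (s : 'I_3 -> 'I_3 -> seq G) :
  planar R G ->
  (forall i j, path (@adj G) (a i) (rcons (s i j) (b j))) ->
  ~ (forall i j k l, i != k -> j != l ->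
      {in a i :: rcons (s i j) (b j), forall z, z \notin a k :: rcons (s k l) (b l)}).
Proof.
move=> [pt [curve [_ arcs curve_pt curve_cross]]] paths disj.
(* There are finitely many pairs of edges, so one distance [d] serves all pairs without a common
   end. *)
have sep : \forall d \near (0 : R)^'+, forall x y x' y' : G, adj x y -> adj x' y' ->
    [&& x != x', x != y', y != x' & y != y'] ->
    forall p q, curve [set x; y]%SET p -> curve [set x'; y']%SET q -> ~ ball p d q.
  apply: filter_forall => x; apply: filter_forall => y.
  apply: filter_forall => x'; apply: filter_forall => y'.
  have [xy|] := boolP (adj x y); last by move=> _; apply: nearW.
  have [xy'|] := boolP (adj x' y'); last by move=> _; apply: nearW.
  have [xyxy'|] := boolP [&& x != x', x != y', y != x' & y != y']; last by move=> _; apply: nearW.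
  have cxy := arc_compact (arcs _ _ xy); have cxy' := arc_compact (arcs _ _ xy').
  (* A common point of the two arcs would be the image of a vertex, which would then be an end of
     both edges. *)
  have : curve [set x; y]%SET `&` curve [set x'; y']%SET = set0.
    rewrite -subset0 => q [q1 q2].
    have [|z _ zq] := curve_cross x y x' y' xy xy' _ q (conj q1 q2).
      move/setP/(_ x); rewrite !inE eqxx => /esym.
      by case/and4P: xyxy' => /negPf-> /negPf->.
    rewrite -zq in q1 q2.
    have [] := curve_pt _ _ _ xy q1; have [] := curve_pt _ _ _ xy' q2;
      by move=> zx' zx; move: xyxy'; rewrite -zx -zx' eqxx ?andbF.
  move/(compact_separated cxy (compact_closed (@norm_hausdorff _ _) cxy')).
  by apply: filterS => d sepd _ _ _.
have [d [d0 sepd]] : exists d : R, 0 < d /\ forall x y x' y' : G, adj x y -> adj x' y' ->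
    [&& x != x', x != y', y != x' & y != y'] ->
    forall p q, curve [set x; y]%SET p -> curve [set x'; y']%SET q -> ~ ball p d q.
  near ((0 : R)^'+) => d; exists d; split; first by near: d; exact: nbhs_right_gt.
  by near: d.
(* Points within [2 * e] of a common lattice point differ by at most [4 * e < d] in each
   coordinate. *)
pose e := d / 5.
have e0 : 0 < e by rewrite divr_gt0.
pose L i j := a i :: rcons (s i j) (b j).
have /choice[p pP] : forall ij : 'I_3 * 'I_3, exists p,
   [/\ path rook (cell e (pt (a ij.1))) p,
     last (cell e (pt (a ij.1))) p = cell e (pt (b ij.2)) &
     forall z, z \in cell e (pt (a ij.1)) :: p -> close_to e (drawn curve (L ij.1 ij.2)) z].
  move=> [i j] /=; have := paths i j => /(reach_path arcs e0).
  by rewrite size_rcons last_rcons; apply.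
apply: (@no_disjoint_K33_walks (fun i => cell e (pt (a i))) (fun j => cell e (pt (b j)))
   (fun i j => p (i, j))) => [i j|i j|i j k l ik jl].
- by have [] := pP (i, j).
- by have [] := pP (i, j).
move=> z zij; apply/negP => zkl.
have [_ _ /(_ z zij)] := pP (i, j); have [_ _ /(_ z zkl)] := pP (k, l).
move=> [q [x' [y' [/= x'L y'L xy' x'q]]] [q1 q2]] [r [x [y [/= xL yL xy xr]]] [r1 r2]].
have neq u v : u \in L i j -> v \in L k l -> u != v.
  by move=> uL vL; apply: contraNneq (disj i j k l ik jl u uL) => ->.
have disj_xy : [&& x != x', x != y', y != x' & y != y'].
  by rewrite (neq _ _ xL x'L) (neq _ _ xL y'L) (neq _ _ yL x'L) (neq _ _ yL y'L).
apply: (sepd x y x' y' xy xy' disj_xy r q xr x'q).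
have ed : 5 * e = d by rewrite /e; lra.
rewrite -ed; move: q1 q2 r1 r2; rewrite !ler_norml.
by move=> ? ? ? ?; split; rewrite /ball /= ltr_norml; lra.
Unshelve. all: by end_near.
Qed.

End Nonplanarity.

(** * The 5-cycles of a planar triangle-free graph of diameter two *)

Lemma uniq_flatten_index (T : eqType) (ss : seq (seq T)) (x : T) (m n : nat) :
  uniq (flatten ss) -> x \in nth [::] ss m -> x \in nth [::] ss n -> m = n.
Proof.
have mem_flat (rr : seq (seq T)) k : x \in nth [::] rr k -> x \in flatten rr.
  elim: rr k => [|r rr IH] [|k] //=; rewrite mem_cat; first by move=> ->.
  by move=> /IH ->; rewrite orbT.
elim: ss m n => [|s ss IH] [|m] [|n] //=; rewrite cat_uniq => /and3P[_ /hasPn dss uss].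
- by move=> xs /mem_flat /dss; rewrite /= xs.
- by move=> /mem_flat /dss /= /negPf ->.
- by move=> xm xn; congr _.+1; apply: IH xm xn.
Qed.

(** The subdivided edges [a0 b2], [a1 b0], [a2 b1] form a perfect matching of [K_{3,3}]; this
    pattern covers all the configurations below. *)
Lemma no_K33_subdivision (R : realType) (G : sgraph) (a0 a1 a2 b0 b1 b2 : G) (p q r : seq G) :
  planar R G ->
  adj a0 b0 -> adj a0 b1 -> path (@adj G) a0 (rcons p b2) ->
  path (@adj G) a1 (rcons q b0) -> adj a1 b1 -> adj a1 b2 ->
  adj a2 b0 -> path (@adj G) a2 (rcons r b1) -> adj a2 b2 ->
  ~ uniq [:: a0, a1, a2, b0, b1, b2 & p ++ q ++ r].
Proof.
move=> Gp a00 a01 a02 a10 a11 a12 a20 a21 a22 U.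
pose a (i : 'I_3) := nth a0 [:: a0; a1; a2] i.
pose b (j : 'I_3) := nth a0 [:: b0; b1; b2] j.
(* Blocks 0 to 2 hold the [a i], 3 to 5 the [b j], 6 to 8 the inner vertices of the subdivided
   edges; block 9 is empty and serves the other six edges. Disjointness of paths becomes a statement
   on block numbers. *)
pose boxes := [:: [:: a0]; [:: a1]; [:: a2]; [:: b0]; [:: b1]; [:: b2]; p; q; r; [::]].
pose box (i j : 'I_3) := match val i, val j with 0, 2 => 6 | 1, 0 => 7 | 2, 1 => 8 | _, _ => 9 end.
pose s (i j : 'I_3) := nth [::] boxes (box i j).
apply: (@planar_no_K33 R G a b s Gp).
  by case=> [[|[|[|?]]] // ?] [[|[|[|?]]] // ?]; rewrite /a /b /s /box /=; rewrite ?andbT.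
move=> i j k l ik jl z zij; apply/negP => zkl.
have Ub : uniq (flatten boxes) by rewrite /= cats0.
pose idx (i j : 'I_3) : seq nat := [:: val i; 3 + val j; box i j].
have idxP (i' j' : 'I_3) : z \in a i' :: rcons (s i' j') (b j') ->
    exists2 m, m \in idx i' j' & z \in nth [::] boxes m.
  rewrite in_cons mem_rcons in_cons => /or3P[/eqP->|/eqP->|zs].
  - exists (val i'); first by rewrite !inE eqxx.
    by case: i' => [[|[|[|?]]] // ?]; rewrite /= inE.
  - exists (3 + val j'); first by rewrite !inE eqxx orbT.
    by case: j' => [[|[|[|?]]] // ?]; rewrite /= inE.
  - by exists (box i' j'); rewrite ?inE ?eqxx ?orbT.
have [m mi zm] := idxP _ _ zij; have [n nk zn] := idxP _ _ zkl.
have mn := uniq_flatten_index Ub zm zn; rewrite -{}mn {zn} in nk.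
have m9 : m != 9 by apply: contraTneq zm => ->.
(* Paths of independent edges share at most the empty block, by a check of 81 index choices. *)
have {idxP Ub zm} : [forall i : 'I_3, forall j : 'I_3, forall k : 'I_3, forall l : 'I_3,
    (i != k) ==> (j != l) ==> all (fun m => (m == 9) || (m \notin idx k l)) (idx i j)].
  by do 4![apply/forallP; case=> [[|[|[|?]]] // ?]].
move=> /forallP/(_ i)/forallP/(_ j)/forallP/(_ k)/forallP/(_ l).
by rewrite ik jl => /allP/(_ m mi); rewrite nk (negPf m9).
Qed.

Lemma planar_no_biclique33 (R : realType) (G : sgraph) (a0 a1 a2 b0 b1 b2 : G) :
  planar R G -> uniq [:: a0; a1; a2; b0; b1; b2] ->
  ~ (forall x y, x \in [:: a0; a1; a2] -> y \in [:: b0; b1; b2] -> adj x y).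
Proof.
move=> Gp U adjG.
apply: (@no_K33_subdivision R G a0 a1 a2 b0 b1 b2 [::] [::] [::]) => //=; rewrite ?andbT //;
by apply: adjG; rewrite !inE eqxx ?orbT.
Qed.

(* Closes a goal whose hypotheses contain a loop, a triangle or an adjacency
   and its negation, once the adjacencies are made symmetric. *)
Ltac triangle tf :=
  exfalso;
  repeat match goal with
  | H : is_true (adj ?x ?y) |- _ =>
    lazymatch goal with
    | _ : is_true (adj y x) |- _ => fail
    | _ => let H' := fresh in have H' := H; rewrite adj_sym in H'
    end
  end;
  match goal with
  | H : is_true (adj ?x ?x) |- _ => by rewrite adj_irrefl in H
  | H : is_true (adj ?x ?y), N : is_true (~~ adj ?x ?y) |- _ => by rewrite H in N
  | H : is_true (adj ?x ?y), K : is_true (adj ?y ?z), L : is_true (adj ?z ?x) |- _ =>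
    exact: (tf x y z (And3 H K L))
  | H : is_true (?x != ?x) |- _ => by rewrite eqxx in H
  end.

Ltac adjacent :=
  rewrite /= ?andbT; do ?(apply/andP; split); first [done | by rewrite adj_sym].

Ltac distinct tf :=
  rewrite /= ?inE ?negb_or; do ?(apply/andP; split) => //;
  try (apply/eqP => ?; subst; triangle tf).

Record c5 (G : sgraph) (u0 u1 u2 u3 u4 : G) : Prop := C5_intro {
  c501 : adj u0 u1; c512 : adj u1 u2; c523 : adj u2 u3; c534 : adj u3 u4; c540 : adj u4 u0 }.

Lemma c5_rot (G : sgraph) (u0 u1 u2 u3 u4 : G) : c5 u0 u1 u2 u3 u4 -> c5 u1 u2 u3 u4 u0.
Proof. by case. Qed.

Lemma c5_rev (G : sgraph) (u0 u1 u2 u3 u4 : G) : c5 u0 u1 u2 u3 u4 -> c5 u0 u4 u3 u2 u1.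
Proof. by case=> ? ? ? ? ?; split; rewrite adj_sym. Qed.

Definition diam_le2 (G : sgraph) :=
  forall x y : G, x != y -> ~~ adj x y -> exists2 z, adj x z & adj z y.

Section C5.
Variables (R : realType) (G : sgraph).
Hypotheses (Gp : planar R G) (tf : triangle_free G) (diam : diam_le2 G).

(** Say that a vertex has the role of [u1] if it is adjacent to [u0] and [u2], and so on. Otherwise
    there is a subdivision with sides [u0, u2, w] and [u1, v, u3]: [u0] reaches [u3] through [u4],
    and [w] reaches [v] directly or through a common neighbour. *)
Lemma c5_consecutive (u0 u1 u2 u3 u4 v w : G) : c5 u0 u1 u2 u3 u4 ->
  adj v u0 -> adj v u2 -> adj w u1 -> adj w u3 -> v = u1 \/ w = u2.
Proof.
move=> [? ? ? ? ?] ? ? ? ?; have [->|?] := eqVneq v u1; first by left.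
have [->|?] := eqVneq w u2; first by right.
exfalso; have vw : v != w by distinct tf.
have [?|nvw] := boolP (adj w v).
  apply: (@no_K33_subdivision R G u0 u2 w u1 v u3 [:: u4] [::] [::] Gp).
  all: try by adjacent.
  by distinct tf.
rewrite eq_sym in vw; have [z ? ?] := diam vw nvw.
apply: (@no_K33_subdivision R G u0 u2 w u1 v u3 [:: u4] [::] [:: z] Gp).
all: try by adjacent.
by distinct tf.
Qed.

(** Otherwise a common neighbour [t] of [x] and [u4] completes a subdivision with sides [v, u2, u4]
    and [u0, x, u3], subdivided by [y], [u1] and [t]. *)
Lemma c5_one_neighbour_aux (u0 u1 u2 u3 u4 v x y : G) : c5 u0 u1 u2 u3 u4 ->
  adj v u0 -> ~~ adj v u2 -> ~~ adj v u3 ->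
  adj v x -> adj x u2 -> adj v y -> adj y u3 -> adj x u4.
Proof.
move=> [? ? ? ? ?] ? ? ? ? ? ? ?; apply/negPn/negP => nxu4.
have xu4 : x != u4 by distinct tf.
have [t ? ?] := diam xu4 nxu4.
apply: (@no_K33_subdivision R G v u2 u4 u0 x u3 [:: y] [:: u1] [:: t] Gp).
all: try by adjacent.
by distinct tf.
Qed.

(** If both fail, the common neighbours [x] of [v, u2] and [y] of [v, u3] have, by the previous
    lemma and its mirror image, the consecutive roles of [u3] and [u2]. *)
Lemma c5_one_neighbour (u0 u1 u2 u3 u4 v : G) : c5 u0 u1 u2 u3 u4 ->
  adj v u0 -> adj v u2 \/ adj v u3.
Proof.
move=> c vu0; have [|nvu2] := boolP (adj v u2); first by left.
have [|nvu3] := boolP (adj v u3); first by right.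
exfalso; have [? ? ? ? ?] := c.
have vu2 : v != u2 by distinct tf.
have vu3 : v != u3 by distinct tf.
have [x ? xu2] := diam vu2 nvu2.
have [y ? yu3] := diam vu3 nvu3.
have xu4 : adj x u4 by apply: (@c5_one_neighbour_aux u0 u1 u2 u3 u4 v x y).
have yu1 : adj y u1.
  by apply: (@c5_one_neighbour_aux u0 u4 u3 u2 u1 v y x) => //; exact: c5_rev.
by have [?|?] := c5_consecutive (c5_rot c) yu1 yu3 xu2 xu4; subst; triangle tf.
Qed.

Lemma c5_consecutive_off (u0 u1 u2 u3 u4 v w z : G) : c5 u0 u1 u2 u3 u4 ->
  ~~ adj z u1 -> ~~ adj z u2 -> adj z v -> adj z w ->
  adj v u0 -> adj v u2 -> adj w u1 -> adj w u3 -> False.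
Proof.
move=> c /negP zu1 /negP zu2 zv zw vu0 vu2 wu1 wu3.
by have [E|E] := c5_consecutive c vu0 vu2 wu1 wu3; [move: zv | move: zw]; rewrite E.
Qed.

(** If [v] had no neighbour on the cycle, each common neighbour of [v] and a cycle vertex would have
    a role by [c5_one_neighbour]; two of these roles turn out consecutive. *)
Lemma c5_dominates (u0 u1 u2 u3 u4 v : G) : c5 u0 u1 u2 u3 u4 ->
  [|| adj v u0, adj v u1, adj v u2, adj v u3 | adj v u4].
Proof.
move=> c0; have c1 := c5_rot c0; have c2 := c5_rot c1; have c3 := c5_rot c2; have c4 := c5_rot c3.
apply: contraT; rewrite !negb_or => /and5P[n0 n1 n2 n3 n4].
have mid u u' : adj u' u -> ~~ adj v u -> ~~ adj v u' -> exists2 w, adj v w & adj w u.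
  by move=> u'u nvu /negP nvu'; apply: diam => //; apply: contraPneq u'u => <-; rewrite adj_sym.
have [e0 e1 e2 e3 e4] := c0.
have [w0 vw0 w0u0] := mid _ _ e4 n0 n4.
have [w1 vw1 w1u1] := mid _ _ e0 n1 n0.
have [w2 vw2 w2u2] := mid _ _ e1 n2 n1.
exfalso; have [w0u2|w0u3] := c5_one_neighbour c0 w0u0; have [w1u3|w1u4] := c5_one_neighbour c1 w1u1.
- exact: (c5_consecutive_off c0 n1 n2 vw0 vw1).
- exact: (c5_consecutive_off c4 n0 n1 vw1 vw0).
(* Here [w0] and [w1] have the non-consecutive roles of [u4] and [u2]; [w2] has that of [u3] or
   [u1], next to the role of [w1]. *)
- have [w2u4|w2u0] := c5_one_neighbour c2 w2u2.
    exact: (c5_consecutive_off c1 n2 n3 vw1 vw2).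
  exact: (c5_consecutive_off c0 n1 n2 vw2 vw1).
- exact: (c5_consecutive_off c3 n4 n0 vw0 vw1).
Qed.

Lemma c5_type_exists (u0 u1 u2 u3 u4 v : G) : c5 u0 u1 u2 u3 u4 ->
  [|| adj v u4 && adj v u1, adj v u0 && adj v u2, adj v u1 && adj v u3,
      adj v u2 && adj v u4 | adj v u3 && adj v u0].
Proof.
move=> c0; have c1 := c5_rot c0; have c2 := c5_rot c1; have c3 := c5_rot c2; have c4 := c5_rot c3.
case/or4P: (c5_dominates v c0) => [vu|vu|vu|/orP[vu|vu]].
- by case: (c5_one_neighbour c0 vu) => vu'; rewrite vu vu' ?orbT.
- by case: (c5_one_neighbour c1 vu) => vu'; rewrite vu vu' ?orbT.
- by case: (c5_one_neighbour c2 vu) => vu'; rewrite vu vu' ?orbT.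
- by case: (c5_one_neighbour c3 vu) => vu'; rewrite vu vu' ?orbT.
- by case: (c5_one_neighbour c4 vu) => vu'; rewrite vu vu' ?orbT.
Qed.

(** The roles filled by a second vertex are pairwise non-consecutive on the 5-cycle, hence lie in a
    pair of non-consecutive ones; a rotation moves this pair to positions 1 and 3. *)
Lemma c5_structure (u0 u1 u2 u3 u4 : G) : c5 u0 u1 u2 u3 u4 ->
  exists x0 x1 x2 x3 x4 : G, c5 x0 x1 x2 x3 x4 /\
    forall v, [|| v == x0, v == x2, v == x4, adj v x0 && adj v x2 | adj v x2 && adj v x4].
Proof.
move=> c0; have c1 := c5_rot c0; have c2 := c5_rot c1; have c3 := c5_rot c2; have c4 := c5_rot c3.
pose twin (p x y : G) := [exists v, [&& v != x, adj v p & adj v y]].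
have consec y0 y1 y2 y3 y4 : c5 y0 y1 y2 y3 y4 -> ~~ (twin y0 y1 y2 && twin y1 y2 y3).
  move=> c; apply/negP => /andP[/existsP[v /and3P[/eqP vy1 v0 v2]]].
  move=> /existsP[w /and3P[/eqP wy2 w1 w3]].
  by case: (c5_consecutive c v0 v2 w1 w3).
have good y0 y1 y2 y3 y4 : c5 y0 y1 y2 y3 y4 ->
    ~~ twin y4 y0 y1 -> ~~ twin y1 y2 y3 -> ~~ twin y3 y4 y0 ->
    exists x0 x1 x2 x3 x4 : G, c5 x0 x1 x2 x3 x4 /\
    forall v, [|| v == x0, v == x2, v == x4, adj v x0 && adj v x2 | adj v x2 && adj v x4].
  move=> c /existsPn t0 /existsPn t2 /existsPn t4; exists y0, y1, y2, y3, y4; split => // v.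
  move: (t0 v) (t2 v) (t4 v) (c5_type_exists v c).
  case: (v == y0) (v == y2) (v == y4) => [] [] [] //=.
  by case: (adj v y0) (adj v y1) (adj v y2) (adj v y3) (adj v y4) => [] [] [] [] [].
move: (consec _ _ _ _ _ c0) (consec _ _ _ _ _ c1) (consec _ _ _ _ _ c2)
  (consec _ _ _ _ _ c3) (consec _ _ _ _ _ c4).
move: (good _ _ _ _ _ c0) (good _ _ _ _ _ c1) (good _ _ _ _ _ c2)
  (good _ _ _ _ _ c3) (good _ _ _ _ _ c4).
case: (twin u4 u0 u1) (twin u0 u1 u2) (twin u1 u2 u3) (twin u2 u3 u4) (twin u3 u4 u0)
  => [] [] [] [] [] //= g0 g1 g2 g3 g4 _ _ _ _ _;
  by [exact: g0 | exact: g1 | exact: g2 | exact: g3 | exact: g4].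
Qed.

End C5.

(** * Straight-line drawings *)

Section StraightDrawing.
Variable R : realType.
Local Open Scope ring_scope.
Local Open Scope classical_set_scope.

Definition segment_pt (p q : R * R) (t : R) : R * R :=
  ((1 - t) * p.1 + t * q.1, (1 - t) * p.2 + t * q.2).

Lemma segment_pt0 p q : segment_pt p q 0 = p.
Proof. by rewrite /segment_pt subr0 !mul1r !mul0r !addr0; case: p. Qed.

Lemma segment_pt1 p q : segment_pt p q 1 = q.
Proof. by rewrite /segment_pt subrr !mul1r !mul0r !add0r; case: q. Qed.

Lemma segment_ptC p q t : segment_pt p q t = segment_pt q p (1 - t).
Proof. by rewrite /segment_pt; congr (_, _); ring. Qed.

Lemma segment_pt_arc (p q : R * R) : p <> q ->
  arc_between (segment_pt p q @` `[0, 1]) p q.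
Proof.
move=> pq; exists (segment_pt p q); split => //; last 2 first.
- exact: segment_pt0.
- exact: segment_pt1.
- apply: continuous_subspaceT => t.
  have aff (a b : R) : (fun s : R => (1 - s) * a + s * b) @ t --> (1 - t) * a + t * b.
    apply: cvgD; apply: cvgMl.
      by apply: cvgB; [exact: cvg_cst | exact: cvg_id].
    exact: cvg_id.
  exact: cvg_pair (aff _ _) (aff _ _).
- move=> s t _ _ [E1 E2]; apply/eqP; rewrite -subr_eq0; apply: contra_notT pq => st.
  case: p q E1 E2 => [p1 p2] [q1 q2] /= E1 E2.
  by congr (_, _); apply: (mulfI st); [move: E1 | move: E2]; lra.
Qed.

Lemma set2_eq (T : finType) (x y x' y' : T) : [set x; y]%SET = [set x'; y']%SET ->
  (x = x' /\ y = y') \/ (x = y' /\ y = x').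
Proof.
move=> E.
have : x \in [set x'; y']%SET by rewrite -E !inE eqxx.
have : y \in [set x'; y']%SET by rewrite -E !inE eqxx orbT.
have : x' \in [set x; y]%SET by rewrite E !inE eqxx.
have : y' \in [set x; y]%SET by rewrite E !inE eqxx orbT.
by rewrite !inE => /orP[]/eqP ? /orP[]/eqP ? /orP[]/eqP ? /orP[]/eqP ?; subst; auto.
Qed.

(** The relation [up] orients the edges, so the segments need to be compared in one parametrization
    only. *)
Lemma straight_planar (G : sgraph) (pt : G -> R * R) (up : rel G) :
  injective pt -> (forall x y, adj x y = up x y || up y x) ->
  (forall x y z t, up x y -> 0 <= t <= 1 -> segment_pt (pt x) (pt y) t = pt z -> t = 0 \/ t = 1) ->
  (forall x y x' y' s t, up x y -> up x' y' -> 0 <= s <= 1 -> 0 <= t <= 1 ->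
     segment_pt (pt x) (pt y) s = segment_pt (pt x') (pt y') t ->
     [\/ s = 0, s = 1 | x = x' /\ y = y']) ->
  planar R G.
Proof.
move=> ptI adjE seg_pt seg_cross.
pose curve (E : {set G}) : set (R * R) := [set q | exists x y t,
  [/\ E = [set x; y]%SET, up x y, 0 <= t <= 1 & segment_pt (pt x) (pt y) t = q]].
have curveE x y : up x y -> curve [set x; y]%SET = segment_pt (pt x) (pt y) @` `[0, 1].
  move=> xy; rewrite predeqE => q; split => [[x' [y' [t [E xy' t01 <-]]]]|[t]].
    have [[-> ->]|[-> ->]] := set2_eq E; first by exists t => //; rewrite /= in_itv.
    exists (1 - t); last by rewrite -segment_ptC.
    by rewrite /= in_itv /=; move/andP: t01 => [? ?]; apply/andP; split; lra.
  by rewrite /= in_itv /= => t01 <-; exists x, y, t.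
have up_neq x y : up x y -> pt x <> pt y.
  by move=> xy /ptI E; have := adj_irrefl x; rewrite adjE {2}E xy.
have arc x y : up x y -> arc_between (curve [set x; y]%SET) (pt x) (pt y).
  by move=> xy; rewrite curveE //; apply: segment_pt_arc; exact: up_neq.
have setC x y : [set x; y]%SET = [set y; x]%SET :> {set G} by rewrite finset.setUC.
exists pt, curve; split => //.
- move=> x y; rewrite adjE => /orP[xy|yx]; first exact: arc.
  rewrite setC; have := arc _ _ yx; rewrite curveE //.
  rewrite (_ : segment_pt (pt y) (pt x) @` `[0, 1] = segment_pt (pt x) (pt y) @` `[0, 1]).
    by move=> _; apply: segment_pt_arc => /esym; exact: up_neq.
  rewrite predeqE => q; split => -[t t01 <-]; exists (1 - t); try by rewrite -segment_ptC.
    by move: t01; rewrite /= !in_itv /= => /andP[? ?]; apply/andP; split; lra.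
  by move: t01; rewrite /= !in_itv /= => /andP[? ?]; apply/andP; split; lra.
- move=> x y z _ [x' [y' [t [E xy' t01 tz]]]].
  suff: z = x' \/ z = y' by have [[-> ->]|[-> ->]] := set2_eq E; tauto.
  have [t0|t1] := seg_pt _ _ _ _ xy' t01 tz.
    by left; apply: ptI; rewrite -tz t0 segment_pt0.
  by right; apply: ptI; rewrite -tz t1 segment_pt1.
- move=> x1 y1 x2 y2 _ _ E q [[x [y [s [Exy xy s01 sq]]]] [x' [y' [t [Exy' xy' t01 tq]]]]].
  have st : segment_pt (pt x) (pt y) s = segment_pt (pt x') (pt y') t by rewrite sq tq.
  have [s0|s1|[xx' yy']] := seg_cross _ _ _ _ _ _ xy xy' s01 t01 st.
  + by exists x => //; rewrite -sq s0 segment_pt0.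
  + by exists y => //; rewrite -sq s1 segment_pt1.
  + by case: E; rewrite Exy Exy' xx' yy'.
Qed.

(** * A drawing on three horizontal levels *)

(* The pair (i, k) stands for the k-th copy of the vertex u_i of the 5-cycle. *)
Definition level_pt (p : nat * nat) : R * R :=
  match p.1 with
  | 0%N => (-1, -1) | 1%N => (- p.2.+1%:R, 0) | 2%N => (0, 1)
  | 3%N => (p.2.+1%:R, 0) | _ => (1, -1) end.

Definition level_ok (p : nat * nat) : bool :=
  (p.1 < 5)%N && ((p.2 == 0)%N || (p.1 == 1)%N || (p.1 == 3)%N).

(** Every edge points upwards except the horizontal one from [u_0] to [u_4], so that height
    determines the parameter on the others. *)
Definition level_up (p q : nat * nat) : bool :=
  (p.1, q.1) \in [:: (0, 1); (1, 2); (3, 2); (4, 3); (0, 4)]%N.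

Ltac split_pair E :=
  let E1 := fresh "E1" in let E2 := fresh "E2" in
  have /= E1 := congr1 fst E; have /= E2 := congr1 snd E; clear E.

Lemma natr_inj (k l : nat) : k%:R = l%:R :> R -> k = l.
Proof. by move=> /eqP; rewrite eqr_nat => /eqP. Qed.

Lemma level_pt_inj (p q : nat * nat) :
  level_ok p -> level_ok q -> level_pt p = level_pt q -> p = q.
Proof.
case: p q => [[|[|[|[|[|i]]]]] k] [[|[|[|[|[|j]]]]] l] //; rewrite /level_ok /level_pt /=.
all: rewrite ?orbT ?orbF => /eqP k_ok /eqP l_ok E; split_pair E.
all: have k0 : 0 <= k%:R :> R by rewrite ler0n.
all: have l0 : 0 <= l%:R :> R by rewrite ler0n.
all: rewrite -?natr1 in E1 E2.
all: first [by rewrite k_ok l_ok | clear k_ok l_ok].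
all: by first [exfalso; lra | congr (_, _); apply: natr_inj; lra].
Qed.

Lemma level_segment_pt (p q z : nat * nat) (t : R) : level_up p q -> level_ok z ->
  0 <= t <= 1 -> segment_pt (level_pt p) (level_pt q) t = level_pt z -> t = 0 \/ t = 1.
Proof.
case: p q z => [[|[|[|[|[|i]]]]] k] [[|[|[|[|[|j]]]]] l] [[|[|[|[|[|m]]]]] h] //.
all: rewrite /level_up /level_pt /segment_pt => _ _ /andP[t0 t1] /= E; split_pair E.
all: have h0 : 0 <= h%:R :> R by rewrite ler0n.
all: have k0 : 0 <= k%:R :> R by rewrite ler0n.
all: have l0 : 0 <= l%:R :> R by rewrite ler0n.
all: rewrite -?natr1 in E1 E2.
all: first [by left; lra | by right; lra | exfalso; nra].
Qed.

Lemma level_segment_cross (p q p' q' : nat * nat) (s t : R) :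
  level_ok p -> level_ok q -> level_ok p' -> level_ok q' ->
  level_up p q -> level_up p' q' -> 0 <= s <= 1 -> 0 <= t <= 1 ->
  segment_pt (level_pt p) (level_pt q) s = segment_pt (level_pt p') (level_pt q') t ->
  [\/ s = 0, s = 1 | p = p' /\ q = q'].
Proof.
case: p q p' q' => [[|[|[|[|[|?]]]]] k] [[|[|[|[|[|?]]]]] l] //
  [[|[|[|[|[|?]]]]] m] [[|[|[|[|[|?]]]]] n] //.
all: rewrite /level_ok /level_up /level_pt /segment_pt /= ?orbF ?orbT => /eqP k_ok /eqP l_ok.
all: move=> /eqP m_ok /eqP n_ok _ _ /andP[s0 s1] /andP[t0 t1] E; split_pair E.
all: have k0 : 0 <= k%:R :> R by rewrite ler0n.
all: have l0 : 0 <= l%:R :> R by rewrite ler0n.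
all: have m0 : 0 <= m%:R :> R by rewrite ler0n.
all: have n0 : 0 <= n%:R :> R by rewrite ler0n.
all: rewrite -?natr1 in E1 E2.
all: first [by apply: Or33; rewrite k_ok l_ok m_ok n_ok | move: k_ok l_ok m_ok n_ok].
(* By the choice of orientation, segments between the same two levels can meet only at equal
   parameters. *)
all: try (have st : s = t by clear -E1 E2; lra); try subst t.
all: try (have t00 : t = 0 by clear -E1 E2; lra); try subst t.
all: have s1' : 0 <= 1 - s by rewrite subr_ge0.
(* Products of a parameter and a copy number are atoms for [lra]; their signs tell the left half of
   the drawing from the right. *)
all: have sk := mulr_ge0 s1' k0; have sl := mulr_ge0 s0 l0.
all: have sm := mulr_ge0 s1' m0; have sn := mulr_ge0 s0 n0.
all: try by move=> _ _ _ _; first [apply: Or31; lra | apply: Or32; lra | exfalso; lra].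
(* Four cases remain: two segments joining the same end to copies of one vertex. They meet only at
   the shared end unless the copies coincide. *)
- move=> -> _ -> _; have /eqP : s * (l%:R - n%:R) = 0 by lra.
  rewrite mulf_eq0 subr_eq0 => /orP[/eqP|/eqP/natr_inj ->]; first exact: Or31.
  exact: Or33.
- move=> _ -> _ ->; have /eqP : (1 - s) * (k%:R - m%:R) = 0 by lra.
  rewrite mulf_eq0 !subr_eq0 => /orP[/eqP|/eqP/natr_inj ->]; last exact: Or33.
  by move=> <-; exact: Or32.
- move=> _ -> _ ->; have /eqP : (1 - s) * (k%:R - m%:R) = 0 by lra.
  rewrite mulf_eq0 !subr_eq0 => /orP[/eqP|/eqP/natr_inj ->]; last exact: Or33.
  by move=> <-; exact: Or32.
- move=> -> _ -> _; have /eqP : s * (l%:R - n%:R) = 0 by lra.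
  rewrite mulf_eq0 subr_eq0 => /orP[/eqP|/eqP/natr_inj ->]; first exact: Or31.
  exact: Or33.
Qed.

Lemma level_planar (G : sgraph) (c : G -> nat * nat) :
  injective c -> (forall x, level_ok (c x)) ->
  (forall x y, adj x y = level_up (c x) (c y) || level_up (c y) (c x)) -> planar R G.
Proof.
move=> cI c_ok c_adj.
apply: (@straight_planar G (level_pt \o c) (fun x y => level_up (c x) (c y))) => //.
- by move=> x y /level_pt_inj -/(_ (c_ok _) (c_ok _)) /cI.
- by move=> x y z t xy t01; apply: level_segment_pt.
- move=> x y x' y' s t xy xy' s01 t01.
  move/level_segment_cross => -/(_ (c_ok _) (c_ok _) (c_ok _) (c_ok _) xy xy' s01 t01).
  by case=> [->|->|[/cI-> /cI->]]; [exact: Or31 | exact: Or32 | exact: Or33].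
Qed.

End StraightDrawing.

(** * The classification *)

(** A path made simple has fewer than [#|G|] edges, so the search in [dist] succeeds. *)
Lemma has_walk_dist (G : sgraph) (x y : G) : connected_graph G -> has_walk (dist x y) x y.
Proof.
move=> conn; have : has (fun n => has_walk n x y) (iota 0 #|G|).
  have /connectP[p /shortenP[q xq uq _] yq] := conn x y.
  apply/hasP; exists (size q).
    by rewrite mem_iota add0n; have := max_card (mem (x :: q)); rewrite (card_uniqP uq).
  by apply/existsP; exists (in_tuple q); rewrite xq yq eqxx.
by move=> h; have := nth_find 0 h; rewrite nth_iota // -[X in _ < X](size_iota 0) -has_find.
Qed.

Lemma two_self_centered_diam (G : sgraph) : two_self_centered G -> diam_le2 G.
Proof.
move=> [conn diam2 _] x y xy nxy.
have : dist x y <= 2.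
  rewrite -diam2; apply: leq_trans (leq_bigmax x).
  exact: (leq_bigmax (F := dist x) y).
have /existsP[[p sp]] := has_walk_dist x y conn.
case: (dist x y) p sp => [|[|[|//]]] [|z [|w [|]]] //= _; rewrite ?andbT.
- by move=> /eqP xy'; rewrite xy' eqxx in xy.
- by move=> /andP[+ /eqP yE]; rewrite yE (negPf nxy).
- by move=> /andP[/andP[xz zw] /eqP <-]; exists z.
Qed.

Lemma bigminn_le (I : finType) (F : I -> nat) (m : nat) (i : I) :
  \big[minn/m]_(j : I) F j <= F i.
Proof.
suff H (s : seq I) : i \in s -> \big[minn/m]_(j <- s) F j <= F i by rewrite H ?mem_index_enum.
elim: s => // j s IH; rewrite inE big_cons => /orP[/eqP <-|/IH]; first exact: geq_minl.
exact/leq_trans/geq_minr.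
Qed.

Lemma dist_adj (G : sgraph) (x y : G) : adj x y -> dist x y <= 1.
Proof.
move=> xy; rewrite leqNgt; apply/negP => d1.
have lt1 : 1 < #|G|.
  by apply: leq_trans d1 _; rewrite -[#|G| in X in _ <= X](size_iota 0) find_size.
have := before_find 0 d1; rewrite nth_iota // add0n => /negbT/negP[]; apply/existsP.
by exists [tuple y]; rewrite /= xy eqxx.
Qed.

Lemma dist_refl (G : sgraph) (x : G) : dist x x = 0.
Proof.
apply/eqP; rewrite -leqn0 leqNgt; apply/negP => d0.
have lt0 : 0 < #|G| by apply/card_gt0P; exists x.
have := before_find 0 d0; rewrite nth_iota // add0n => /negbT/negP[]; apply/existsP.
by exists [tuple]; rewrite /=.
Qed.

(** Otherwise [x] would have eccentricity at most 1, against radius 2. *)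
Lemma two_self_centered_far (G : sgraph) (x : G) : two_self_centered G ->
  exists2 y, x != y & ~~ adj x y.
Proof.
move=> [_ _ rad2]; apply/exists2P; apply: contrapT => /forallNP far.
suff : Defs.radius G <= 1 by rewrite rad2.
apply: leq_trans (bigminn_le _ _ x) _; apply/bigmax_leqP => y _.
have [<-|xy] := eqVneq x y; first by rewrite dist_refl.
by apply: dist_adj; apply/negPn/negP => nxy; apply: (far y).
Qed.

Lemma two_self_centered_inhab (G : sgraph) : two_self_centered G -> exists x : G, True.
Proof.
move=> [_ + _]; rewrite /diameter; have [x _|G0] := pickP (fun _ : G => true); first by exists x.
by rewrite big_pred0.
Qed.

(** * Isomorphisms with the two families *)

Lemma isomorphic_of_surj (G H : sgraph) (g : H -> G) :
  injective g -> (forall x, exists u, g u = x) -> (forall u v, adj (g u) (g v) = adj u v) ->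
  isomorphic G H.
Proof.
move=> gI /choice[h hK] g_adj; exists h.
  by exists g => // u; apply: gI; rewrite hK.
by move=> x y; rewrite -g_adj !hK.
Qed.

Lemma isomorphic_biclique (G : sgraph) (S : {set G}) :
  (forall x y : G, adj x y = (x \in S) (+) (y \in S)) ->
  isomorphic G (biclique #|S| #|~: S|).
Proof.
move=> adjE.
pose g (u : 'I_#|S| + 'I_#|~: S|) : G :=
  match u with inl i => enum_val i | inr j => enum_val j end.
have inS i : g (inl i) \in S by exact: enum_valP.
have ninS j : (g (inr j) \in S) = false by apply/negbTE; rewrite -finset.in_setC; exact: enum_valP.
apply: (@isomorphic_of_surj G (biclique _ _) g).
- move=> [i|i] [j|j] E; first by congr inl; apply: enum_val_inj.
  + by have := inS i; rewrite E ninS.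
  + by have := inS j; rewrite -E ninS.
  + by congr inr; apply: enum_val_inj.
- move=> x; have [xS|xS] := boolP (x \in S).
    by exists (inl (enum_rank_in xS x)); rewrite /g enum_rankK_in.
  have xC : x \in ~: S by rewrite finset.in_setC.
  by exists (inr (enum_rank_in xC x)); rewrite /g enum_rankK_in.
- by move=> [i|i] [j|j]; rewrite adjE ?inS ?ninS.
Qed.

Lemma isomorphic_C5_blowup (G : sgraph) (x0 x1 x2 x3 x4 : G) : triangle_free G ->
  c5 x0 x1 x2 x3 x4 ->
  (forall v, [|| v == x0, v == x2, v == x4, adj v x0 && adj v x2 | adj v x2 && adj v x4]) ->
  exists a b, [/\ 1 <= a, 1 <= b & isomorphic G (C5_blowup13 a b)].
Proof.
move=> tf [c01 c12 c23 c34 c40] types.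
(* Triangle-freeness makes these classes disjoint and forces every adjacency between them to be that
   of the 5-cycle. *)
pose cls (i : nat) (y : G) := match i with
  | 0 => y = x0 | 1 => adj y x0 /\ adj y x2 | 2 => y = x2
  | 3 => adj y x2 /\ adj y x4 | _ => y = x4 end.
have cls_inj i j y : i < 5 -> j < 5 -> cls i y -> cls j y -> i = j.
  by case: i j => [|[|[|[|[|?]]]]] [|[|[|[|[|?]]]]] //= _ _ ci cj;
    repeat match goal with H : _ /\ _ |- _ => destruct H end; subst; triangle tf.
have cls_adj i j y z : i < 5 -> j < 5 -> cls i y -> cls j z ->
    adj y z = (j == i.+1 %% 5) || (i == j.+1 %% 5).
  rewrite /cls; case: i j => [|[|[|[|[|?]]]]] [|[|[|[|[|?]]]]] //= _ _ ci cj;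
    repeat match goal with H : _ /\ _ |- _ => destruct H end; subst;
    first [done | by rewrite adj_sym | by apply/negbTE/negP => ?; triangle tf].
pose A := [set v | adj v x0 && adj v x2]%SET; pose B := [set v | adj v x2 && adj v x4]%SET.
exists #|A|, #|B|; split.
- by apply/card_gt0P; exists x1; rewrite inE [adj x1 x0]adj_sym c01 c12.
- by apply/card_gt0P; exists x3; rewrite inE [adj x3 x2]adj_sym c23 c34.
pose H := C5_blowup13 #|A| #|B|.
pose g (u : H) : G := match val (tag u) with
  | 0 => x0 | 1 => nth x0 (enum A) (tagged u) | 2 => x2
  | 3 => nth x0 (enum B) (tagged u) | _ => x4 end.
have nthA k : k < #|A| -> nth x0 (enum A) k \in A by rewrite cardE -mem_enum => /mem_nth->.
have nthB k : k < #|B| -> nth x0 (enum B) k \in B by rewrite cardE -mem_enum => /mem_nth->.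
have gP (u : H) : cls (val (tag u)) (g u).
  rewrite /g; case: u => [[[|[|[|[|[|i]]]]] i5] k] //=.
    by have := nthA k (ltn_ord k); rewrite inE => /andP.
  by have := nthB k (ltn_ord k); rewrite inE => /andP.
apply: (@isomorphic_of_surj G H g).
- move=> u v guv.
  have tag_uv : tag u = tag v.
    have := gP v; rewrite -guv => cv; apply: val_inj.
    exact: cls_inj (ltn_ord _) (ltn_ord _) (gP u) cv.
  case: u v guv tag_uv => [i k] [j l] /= + ij; case: _ / ij l => l guv.
  congr existT; apply: val_inj; move: guv; rewrite /g /=.
  case: i k l => [[|[|[|[|[|i]]]]] i5] //= k l; rewrite ?ord1 //.
    by move=> /eqP; rewrite nth_uniq ?enum_uniq -?cardE ?ltn_ord // => /eqP.
  by move=> /eqP; rewrite nth_uniq ?enum_uniq -?cardE ?ltn_ord // => /eqP.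
- have sur (y : G) (i : 'I_5) (k : 'I_(C5_weight #|A| #|B| i)) : y = g (existT _ i k) ->
     exists u, g u = y by move=> ->; exists (existT _ i k).
  pose o (i : nat) (i5 : i < 5) : 'I_5 := Ordinal i5.
  have lt1 : 0 < 1 by [].
  move=> y; case/or4P: (types y) => [/eqP->|/eqP->|/eqP->|/orP[yA|yB]].
  + by exists (existT _ (o 0 isT) (Ordinal lt1)).
  + by exists (existT _ (o 2 isT) (Ordinal lt1)).
  + by exists (existT _ (o 4 isT) (Ordinal lt1)).
  + have kA : index y (enum A) < #|A| by rewrite cardE index_mem mem_enum inE.
    exists (existT _ (o 1 isT) (Ordinal kA)); rewrite /g /= nth_index // mem_enum inE //.
  + have kB : index y (enum B) < #|B| by rewrite cardE index_mem mem_enum inE.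
    exists (existT _ (o 3 isT) (Ordinal kB)); rewrite /g /= nth_index // mem_enum inE //.
- by move=> u v; rewrite (cls_adj _ _ _ _ (ltn_ord _) (ltn_ord _) (gP u) (gP v)).
Qed.

Lemma planar_of_biclique (R : realType) (G : sgraph) (d : nat) :
  isomorphic G (biclique 2 d) -> planar R G.
Proof.
move=> [f fbij f_adj].
(* The side of size two becomes [u_0] and [u_2], the other side the copies of [u_1]. *)
pose c (u : biclique 2 d) : nat * nat :=
  match u with inl i => (i.*2, 0) | inr j => (1, val j) end.
apply: (@level_planar R G (c \o f)).
- apply: inj_comp (bij_inj fbij) => -[i|i] [j|j] /= /eqP;
    rewrite xpair_eqE => /andP[/eqP E1 /eqP E2].
  + by congr inl; apply/val_inj/double_inj.
  + by have := odd_double i; rewrite E1.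
  + by have := odd_double j; rewrite -E1.
  + by congr inr; apply: val_inj.
- by move=> x; rewrite /= /c; case: (f x) => [[[|[|?]] ?]|?] //; rewrite /level_ok /= orbT.
- by move=> x y; rewrite -f_adj /= /c; case: (f x) (f y) => [[[|[|?]] ?]|?] [[[|[|?]] ?]|?].
Qed.

Lemma planar_of_C5_blowup (R : realType) (G : sgraph) (a b : nat) :
  isomorphic G (C5_blowup13 a b) -> planar R G.
Proof.
move=> [f fbij f_adj].
pose c (u : C5_blowup13 a b) : nat * nat := (val (tag u), val (tagged u)).
apply: (@level_planar R G (c \o f)).
- apply: inj_comp (bij_inj fbij) => -[i k] [j l] /= [/val_inj ij].
  by case: _ / ij l => l kl; congr existT; apply: val_inj.
- by move=> x; rewrite /= /c; case: (f x) => [[[|[|[|[|[|?]]]]] ?] k] //;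
    rewrite /level_ok /= ?orbT //; case: k => [[|?] ?].
- move=> x y; rewrite -f_adj /= /c.
  by move: (f x) (f y) => [[[|[|[|[|[|?]]]]] ?] ?] [[[|[|[|[|[|?]]]]] ?] ?].
Qed.

Theorem theorem3 (R : realType) (G : sgraph)
    (G_tf : triangle_free G) (G_sc : two_self_centered G) :
  planar R G <->
    (exists d : nat, 2 <= d /\ isomorphic G (biclique 2 d)) \/
    (exists a b : nat,
       [/\ 1 <= a, 1 <= b & isomorphic G (C5_blowup13 a b)]).
Proof.
split=> [Gp|[[d [_ /planar_of_biclique]]|[a [b [_ _ /planar_of_C5_blowup]]]]] //.
have diam := two_self_centered_diam G_sc.
have far x := two_self_centered_far x G_sc.
have [v _] := two_self_centered_inhab G_sc.
pose S := [set x | adj v x]%SET.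
(* Adjacent non-neighbours [x, y] of [v] close a 5-cycle through common neighbours with [v];
   otherwise [S] and its complement are both independent. *)
have [/existsP[x /existsP[y /and3P[xS yS xy]]]|] :=
    boolP [exists x, exists y, [&& x \notin S, y \notin S & adj x y]].
  right; rewrite !inE in xS yS.
  have vx : v != x by apply: contraNneq yS => ->.
  have vy : v != y by apply: contraNneq xS => ->; rewrite adj_sym.
  have [a va ax] := diam _ _ vx xS; have [b vb b_y] := diam _ _ vy yS.
  have c : c5 v a x y b by split => //; rewrite adj_sym.
  have [x0 [x1 [x2 [x3 [x4 [c' types]]]]]] := c5_structure Gp G_tf diam c.
  exact: isomorphic_C5_blowup c' types.
rewrite negb_exists => /forallP nE.
have indep x y : x \notin S -> y \notin S -> ~~ adj x y.
  by move=> xS yS; have := nE x; rewrite negb_exists => /forallP/(_ y); rewrite xS yS.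
have indepS x y : x \in S -> y \in S -> ~~ adj x y.
  by rewrite !inE => vx vy; apply/negP => xy; triangle G_tf.
(* A common neighbour of non-adjacent vertices on opposite sides would be adjacent to a vertex of
   its own side. *)
have cross x y : x \in S -> y \notin S -> adj x y.
  move=> xS yS; apply: contraT => nxy.
  have [|z xz zy] := diam x y _ nxy; first by apply: contraNneq yS => <-.
  have [zS|zS] := boolP (z \in S); first by have := indepS x z xS zS; rewrite xz.
  by have := indep z y zS yS; rewrite zy.
have adjE x y : adj x y = (x \in S) (+) (y \in S).
  have [xS|xS] := boolP (x \in S); have [yS|yS] := boolP (y \in S) => /=.
  - exact/negbTE/indepS.
  - exact: cross.
  - by rewrite adj_sym; exact: cross.
  - exact/negbTE/indep.
(* Each vertex has a non-neighbour other than itself, necessarily on its own side, so both sides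
   have at least two vertices. *)
have two (T : {set G}) x : x \in T -> (forall y, ~~ adj x y -> y \in T) -> 1 < #|T|.
  move=> xT inT; have [y xy nxy] := far x.
  by apply/card_gt1P; exists x, y; split => //; exact: inT.
have [y vy nvy] := far v.
have [a va _] := diam _ _ vy nvy.
have S2 : 1 < #|S|.
  apply: (two S a) => [|z]; first by rewrite inE.
  by rewrite adjE !inE va /= negbK.
have C2 : 1 < #|~: S|.
  apply: (two _ v) => [|z]; first by rewrite !inE adj_irrefl.
  by rewrite !inE.
left; have [S3|S3] := ltnP 2 #|S|; last first.
  exists #|~: S|; split => //.
  have <- : #|S| = 2 by apply/eqP; rewrite eqn_leq S3.
  exact: isomorphic_biclique.
have [C3|C3] := ltnP 2 #|~: S|; last first.
  exists #|S|; split => //.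
  have <- : #|~: S| = 2 by apply/eqP; rewrite eqn_leq C3.
  rewrite -{2}[S]finset.setCK; apply: isomorphic_biclique => x z.
  by rewrite adjE !inE; case: (adj v x) (adj v z) => [] [].
exfalso.
have /card_gt2P[a0 [a1 [a2 [[a0S a1S a2S] [a01 a12 a20]]]]] := S3.
have /card_gt2P[b0 [b1 [b2 [[b0S b1S b2S] [b01 b12 b20]]]]] := C3.
rewrite !finset.in_setC in b0S b1S b2S.
have ab x z : x \in S -> z \notin S -> x != z by move=> xS; apply: contraNneq => <-.
apply: (planar_no_biclique33 (a0 := a0) (a1 := a1) (a2 := a2) (b0 := b0) (b1 := b1) (b2 := b2) Gp).
  rewrite /= !inE !negb_or a01 a12 b01 b12 (eq_sym a0) a20 (eq_sym b0 b2) b20.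
  by rewrite !ab.
by move=> x z; rewrite !inE => /or3P[]/eqP-> /or3P[]/eqP->; exact: cross.
Qed.
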